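(* Let $\mathbf{w}\in\mathcal{K}_{m+}\setminus\{\mathbf{0}\}\subset\mathbb{R}^n$, $\varepsilon>0$, and $\mathbf{v}\in\mathbb{R}^n$. If $\Omega_{\mathbf{w}}(\mathbf{v})\le\varepsilon$, then $\mathrm{proj}_{\mathcal{G}_\varepsilon^{\mathbf{w}}}(\mathbf{v})=\mathbf{v}$. If $\Omega_{\mathbf{w}}(\mathbf{v})>\varepsilon$, let $\mathbf{u}=|\mathbf{v}|_{\downarrow}=\mathbf{P}(|\mathbf{v}|)|\mathbf{v}|$, let $\bar{w}=\|\mathbf{w}\|_1/n$, and define $$g(\theta)=\mathbf{w}^T\,\mathrm{proj}_{\mathcal{K}_{m+}}(\mathbf{u}-\theta\,\mathbf{w})-\varepsilon,\qquad\theta\ge 0.$$ Then $g$ has a root in the interval $[0,\,u_1/\bar{w}]$, and for any root $\theta^*$ of $g$ in this interval, $$\mathrm{proj}_{\mathcal{G}_\varepsilon^{\mathbf{w}}}(\mathbf{v})=\mathrm{sign}(\mathbf{v})\odot\bigl(\mathbf{P}(|\mathbf{v}|)^T\,\mathrm{proj}_{\mathcal{K}_{m+}}(\mathbf{u}-\theta^*\mathbf{w})\bigr).$$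
   Context: $\mathcal{K}_{m+}=\{\mathbf{x}\in\mathbb{R}^n: x_1\ge x_2\ge\cdots\ge x_n\ge 0\}$ is the monotone non-negative cone. For $\mathbf{x}\in\mathbb{R}^n$, $|\mathbf{x}|$ is the vector of absolute values of its components, $|\mathbf{x}|_{\downarrow}$ is that vector sorted in non-increasing order, and $\mathbf{P}(|\mathbf{x}|)$ is a permutation matrix (ties broken arbitrarily) such that $|\mathbf{x}|_{\downarrow}=\mathbf{P}(|\mathbf{x}|)\,|\mathbf{x}|$. The ordered weighted $\ell_1$ (OWL) norm is $\Omega_{\mathbf{w}}(\mathbf{x})=\mathbf{w}^T|\mathbf{x}|_{\downarrow}$, and $\mathcal{G}_\varepsilon^{\mathbf{w}}=\{\mathbf{x}\in\mathbb{R}^n:\Omega_{\mathbf{w}}(\mathbf{x})\le\varepsilon\}$. $\mathrm{proj}_C$ denotes the Euclidean projection onto a closed convex set $C$; $\mathrm{sign}$ is applied component-wise and $\odot$ is the entry-wise product. *)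

(* Defs.v *)
From mathcomp Require Import all_boot all_order all_algebra.
From mathcomp Require Import boolp classical_sets reals.

Set Implicit Arguments.
Unset Strict Implicit.
Unset Printing Implicit Defensive.

Import Order.TTheory GRing.Theory Num.Theory.

Local Open Scope classical_set_scope.
Local Open Scope ring_scope.

(* Vectors of R^n are column vectors 'cV[R]_n; indices start at 0. *)

Definition dotv (R : realType) (n : nat) (x y : 'cV[R]_n) : R :=
  (x^T *m y) 0 0.

Definition l1norm (R : realType) (n : nat) (x : 'cV[R]_n) : R :=
  \sum_(i < n) `|x i 0|.

Definition l2norm (R : realType) (n : nat) (x : 'cV[R]_n) : R :=
  Num.sqrt (\sum_(i < n) x i 0 ^+ 2).

Definition absv (R : realType) (n : nat) (x : 'cV[R]_n) : 'cV[R]_n :=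
  map_mx Num.norm x.

Definition signv (R : realType) (n : nat) (x : 'cV[R]_n) : 'cV[R]_n :=
  map_mx Num.sg x.

Definition hadamard (R : realType) (n : nat) (x y : 'cV[R]_n) : 'cV[R]_n :=
  map2_mx *%R x y.

Definition sortv_decr (R : realType) (n : nat) (x : 'cV[R]_n) : 'cV[R]_n :=
  \col_(i < n) (sort >=%R [seq x j 0 | j <- enum 'I_n])`_i.

Definition monotone_nonneg_cone (R : realType) (n : nat) : set 'cV[R]_n :=
  [set x | (forall i j : 'I_n, (i <= j)%N -> x j 0 <= x i 0) /\
           (forall i : 'I_n, 0 <= x i 0)].

Definition owl_norm (R : realType) (n : nat) (w x : 'cV[R]_n) : R :=
  dotv w (sortv_decr (absv x)).

Definition owl_ball (R : realType) (n : nat) (w : 'cV[R]_n) (eps : R) :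
    set 'cV[R]_n :=
  [set x | owl_norm w x <= eps].

Definition is_proj (R : realType) (n : nat) (C : set 'cV[R]_n)
    (x p : 'cV[R]_n) : Prop :=
  C p /\ forall q : 'cV[R]_n, C q -> l2norm (x - p) <= l2norm (x - q).

(* [xget] picks a nearest point of C to x, with default value 0 when there is
   none; when C is nonempty, closed and convex, the nearest point exists and
   is unique, so the default is never used. *)
Definition proj (R : realType) (n : nat) (C : set 'cV[R]_n) (x : 'cV[R]_n) :
    'cV[R]_n :=
  xget 0 [set p | is_proj C x p].

Arguments monotone_nonneg_cone : clear implicits.

(* Main.v *)
(** Let [K] be the monotone cone, [p] the projection of [u - theta w] onto [K],
    and [x] the right-hand side of the formula. It suffices to check
    [<v - x, q - x> <= 0] for all [q] in the OWL ball. The key point is that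
    [u - p] again lies in [K]. Its entries are then nonnegative, so that
    [|x|] sorts to [p] and [Omega_w x = w^T p = eps]; and, [u - p] being
    decreasing, the rearrangement inequality and the polarity of
    [u - theta w - p] to [K] give
    [<v - x, q> <= <u - p, |q| sorted> <= theta Omega_w q <= theta eps],
    while [<v - x, x> = <u - p, p> = theta eps] by orthogonality.
    The root comes from the intermediate value theorem: [g] is Lipschitz,
    [g 0 > 0], and Chebyshev's sum inequality shows that at the right end of
    the interval [u - theta w] is polar to [K], hence projects to [0]. *)

Require Import Defs.
From mathcomp Require Import all_boot all_order all_algebra fingroup perm.
From mathcomp Require Import boolp classical_sets reals.
From mathcomp Require Import topology normedtype derive.
From mathcomp Require Import ring lra.

Set Implicit Arguments.
Unset Strict Implicit.
Unset Printing Implicit Defensive.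

Import Order.TTheory GRing.Theory Num.Theory.
Import numFieldTopology.Exports numFieldNormedType.Exports.

Local Open Scope classical_set_scope.
Local Open Scope ring_scope.

(** * Inner product and variational inequalities for projections *)

Section InnerProduct.
Context {R : realType} {n : nat}.
Implicit Types (x y z p q : 'cV[R]_n) (C : set 'cV[R]_n).

Lemma dotvE x y : dotv x y = \sum_i x i 0 * y i 0.
Proof. by rewrite /dotv mxE; apply: eq_bigr => i _; rewrite mxE. Qed.

Lemma dotvC x y : dotv x y = dotv y x.
Proof. by rewrite !dotvE; apply: eq_bigr => i _; rewrite mulrC. Qed.

Lemma dotvDr x y z : dotv x (y + z) = dotv x y + dotv x z.
Proof. by rewrite /dotv mulmxDr mxE. Qed.

Lemma dotvNr x y : dotv x (- y) = - dotv x y.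
Proof. by rewrite /dotv mulmxN mxE. Qed.

Lemma dotvZr k x y : dotv x (k *: y) = k * dotv x y.
Proof. by rewrite /dotv -scalemxAr mxE. Qed.

Lemma dotvDl x y z : dotv (y + z) x = dotv y x + dotv z x.
Proof. by rewrite !(dotvC _ x) dotvDr. Qed.

Lemma dotvNl x y : dotv (- y) x = - dotv y x.
Proof. by rewrite !(dotvC _ x) dotvNr. Qed.

Lemma dotvZl k x y : dotv (k *: y) x = k * dotv y x.
Proof. by rewrite !(dotvC _ x) dotvZr. Qed.

Definition dotv_bilin := (dotvDr, dotvNr, dotvZr, dotvDl, dotvNl, dotvZl).

Lemma dotv0r x : dotv x 0 = 0.
Proof. by rewrite /dotv mulmx0 mxE. Qed.

Lemma dotvv_ge0 x : 0 <= dotv x x.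
Proof. by rewrite dotvE sumr_ge0 // => i _; rewrite -expr2 sqr_ge0. Qed.

Lemma dotvv_eq0 x : dotv x x = 0 -> x = 0.
Proof.
rewrite dotvE => /eqP; rewrite psumr_eq0 => [/allP x0|i _].
  apply/colP => i; rewrite mxE; apply/eqP.
  by have := x0 i (mem_index_enum i); rewrite /= mulf_eq0 orbb.
by rewrite -expr2 sqr_ge0.
Qed.

Lemma dotv_delta x i k : dotv x (k *: delta_mx i 0) = k * x i 0.
Proof.
rewrite dotvE (bigD1 i) //= big1 ?addr0 => [|j ji].
  by rewrite !mxE !eqxx mulr1 mulrC.
by rewrite !mxE (negPf ji) mulr0 mulr0.
Qed.

Lemma ler_l2norm x y : (l2norm x <= l2norm y) = (dotv x x <= dotv y y).
Proof.
have l2normE z : l2norm z = Num.sqrt (dotv z z).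
  by rewrite dotvE; congr Num.sqrt; apply: eq_bigr => i _; rewrite expr2.
by rewrite !l2normE ler_sqrt ?dotvv_ge0.
Qed.

(** The obtuse-angle condition gives [|x - p|^2 + |p - q|^2 <= |x - q|^2] for [q] in [C]. Hence [p]
    is a nearest point, and the one picked by [xget] is at distance 0 from it. *)
Lemma proj_eq C x p : C p -> (forall q, C q -> dotv (x - p) (q - p) <= 0) ->
  proj C x = p.
Proof.
move=> Cp Hp.
have key q : C q -> dotv (x - p) (x - p) + dotv (p - q) (p - q)
    <= dotv (x - q) (x - q).
  move=> Cq; have := Hp q Cq; rewrite !dotv_bilin.
  rewrite (dotvC p x) (dotvC q x) (dotvC q p); lra.
have projp : is_proj C x p.
  split=> // q Cq; rewrite ler_l2norm.
  by apply: le_trans (key q Cq); rewrite lerDl dotvv_ge0.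
have : is_proj C x (proj C x).
  by exact: (@xgetPex _ 0 [set p | is_proj C x p]) (ex_intro _ p projp).
set q := proj C x => -[Cq /(_ p Cp)]; rewrite ler_l2norm => le_qp.
have := key q Cq; have := dotvv_ge0 (p - q) => d0 dle.
apply/esym/eqP; rewrite -subr_eq0; apply/eqP/dotvv_eq0/eqP.
by rewrite eq_le d0 andbT; lra.
Qed.

Lemma is_proj_variational C x p q : is_proj C x p ->
  (forall t, 0 <= t <= 1 -> C (p + t *: (q - p))) ->
  dotv (x - p) (q - p) <= 0.
Proof.
move=> [Cp minp]; move: (q - p) => d Cseg; rewrite leNgt; apply/negP => c0.
have d0 := dotvv_ge0 d.
have cd0 : 0 < dotv (x - p) d + dotv d d by rewrite ltr_wpDr.
(* Write [c = <x - p, d>]. Minimality at step [t > 0] reads [2c <= t |d|^2], while this [t]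
   satisfies [t |d|^2 = c - t c < c]. *)
pose t := dotv (x - p) d / (dotv (x - p) d + dotv d d).
have t0 : 0 < t by rewrite divr_gt0.
have t1 : t <= 1 by rewrite ler_pdivrMr // mul1r lerDl.
have := minp _ (Cseg t _); rewrite (ltW t0) t1 => /(_ isT).
have tE : t * (dotv (x - p) d + dotv d d) = dotv (x - p) d.
  by rewrite mulfVK // gt_eqF.
have -> : x - (p + t *: d) = (x - p) - t *: d by rewrite opprD addrA.
rewrite ler_l2norm; move: (x - p) t t0 {t1} tE {cd0} c0 => e t t0 tE c0.
rewrite !dotv_bilin (dotvC d e) => le_d.
have : t * (2 * dotv e d) <= t * (t * dotv d d) by lra.
rewrite ler_pM2l //.
have : 0 < t * dotv e d by rewrite mulr_gt0.
lra.
Qed.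

End InnerProduct.

(** * The monotone cone and optimality conditions for projecting onto it *)

Section MonotoneCone.
Context {R : realType} {n : nat}.
Implicit Types (x y z p q u w : 'cV[R]_n).

Local Notation K := (monotone_nonneg_cone R n).

Lemma cone0 : K 0.
Proof. by split=> [i j _|i]; rewrite !mxE. Qed.

Lemma coneD x y : K x -> K y -> K (x + y).
Proof.
move=> [x1 x2] [y1 y2]; split=> [i j ij|i]; rewrite !mxE.
  by rewrite lerD ?x1 ?y1.
by rewrite addr_ge0.
Qed.

Lemma coneZ k x : 0 <= k -> K x -> K (k *: x).
Proof.
move=> k0 [x1 x2]; split=> [i j ij|i]; rewrite !mxE.
  by rewrite ler_wpM2l ?x1.
by rewrite mulr_ge0.
Qed.

Lemma cone_variational x p q : is_proj K x p -> K q -> dotv (x - p) (q - p) <= 0.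
Proof.
move=> xp Kq; apply: (is_proj_variational xp) => t /andP[t0 t1].
have -> : p + t *: (q - p) = (1 - t) *: p + t *: q.
  by apply/colP => i; rewrite !mxE; ring.
by apply: coneD; apply: coneZ => //; [lra | case: xp].
Qed.

(** The variational inequality is tested at [0] and at [p + p], which give the two signs. *)
Lemma cone_proj_orthogonal x p : is_proj K x p -> dotv (x - p) p = 0.
Proof.
move=> xp; have [Kp _] := xp; apply/eqP; rewrite eq_le.
have := cone_variational xp cone0.
have := cone_variational xp (coneD Kp Kp).
by rewrite addrK sub0r dotvNr oppr_le0 => -> ->.
Qed.

Lemma cone_proj_polar x p q : is_proj K x p -> K q -> dotv (x - p) q <= 0.
Proof.
move=> xp Kq; have := cone_variational xp Kq.
by rewrite dotvDr dotvNr (cone_proj_orthogonal xp) subr0.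
Qed.

Lemma cone_proj_eq x p : K p -> dotv (x - p) p = 0 ->
  (forall q, K q -> dotv (x - p) q <= 0) -> proj K x = p.
Proof.
move=> Kp orth polar; apply: proj_eq => // q Kq.
by rewrite dotvDr dotvNr orth subr0 polar.
Qed.

End MonotoneCone.

(** * Sorting as a permutation, and its prefix sums *)

Section SortedVectors.
Context {R : realType} {n : nat}.
Implicit Types (x y : 'cV[R]_n).

Lemma sortv_decr_mono x (i j : 'I_n) : (i <= j)%N ->
  sortv_decr x j 0 <= sortv_decr x i 0.
Proof.
move=> ij; rewrite !mxE; apply: (sorted_leq_nth ge_trans ge_refl) => //.
- by apply: sort_sorted => a b; exact: le_total.
- by rewrite inE size_sort size_map size_enum_ord.
- by rewrite inE size_sort size_map size_enum_ord.
Qed.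

Lemma sortv_decr_row_perm (s : 'S_n) x : sortv_decr (row_perm s x) = sortv_decr x.
Proof.
apply/colP => i; rewrite !mxE; congr nth.
apply/perm_sortP; [by move=> a b; exact: le_total|exact: ge_trans|exact: ge_anti|].
under eq_map do rewrite mxE.
rewrite (map_comp (fun j => x j 0) s); apply: perm_map.
apply: uniq_perm => [||i']; rewrite ?(map_inj_uniq (@perm_inj _ s)) ?enum_uniq //.
rewrite mem_enum inE; apply/mapP; exists (s^-1%g i'); rewrite ?mem_enum //.
by rewrite permKV.
Qed.

Lemma sortv_decr_id x : (forall i j : 'I_n, (i <= j)%N -> x j 0 <= x i 0) ->
  sortv_decr x = x.
Proof.
move=> x_mono; apply/colP => i; rewrite mxE sorted_sort.
- by rewrite (nth_map i) ?size_enum_ord // nth_ord_enum.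
- exact: ge_trans.
- rewrite sorted_map; apply: (@sub_sorted _ (relpre val leq)).
    by move=> a b; exact: x_mono.
  by rewrite -sorted_map val_enum_ord; apply: iota_sorted.
Qed.

Lemma sortv_decrP x : exists s : 'S_n, sortv_decr x = row_perm s x.
Proof.
have sz : size (sort >=%R [seq x j 0 | j <- enum 'I_n]) == n.
  by rewrite size_sort size_map size_enum_ord.
have : perm_eq (Tuple sz) [tuple x j 0 | j < n] by rewrite /= perm_sort.
case/tuple_permP => s sE; exists s; apply/colP => i; rewrite !mxE.
rewrite (_ : sort _ _ = tval (Tuple sz)) // sE -tnth_nth.
by rewrite !tnth_mktuple.
Qed.

Lemma sortv_absv_cone x : monotone_nonneg_cone R n (sortv_decr (absv x)).
Proof.
split=> [|i]; first exact: sortv_decr_mono.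
by have [s ->] := sortv_decrP (absv x); rewrite !mxE.
Qed.

(** Subtract [y k] from every entry. The sum of all positive parts does not change under [s]; it
    bounds the permuted prefix sum from above and, [y] being decreasing, equals the unpermuted
    one. *)
Lemma sum_row_perm_prefix (s : 'S_n) y (k : 'I_n) :
  (forall i j : 'I_n, (i <= j)%N -> y j 0 <= y i 0) ->
  \sum_(i < n | (i <= k)%N) y (s i) 0 <= \sum_(i < n | (i <= k)%N) y i 0.
Proof.
move=> y_mono; rewrite -subr_le0 -sumrB.
pose m i := Num.max (y i 0 - y k 0) 0.
have msum : \sum_i m (s i) = \sum_i m i by rewrite [RHS](reindex_inj (@perm_inj _ s)).
have le1 : \sum_(i < n | (i <= k)%N) (y (s i) 0 - y k 0) <= \sum_i m (s i).
  rewrite [leRHS](bigID (fun i : 'I_n => (i <= k)%N)) /=.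
  rewrite -[leLHS]addr0 lerD ?ler_sum ?sumr_ge0 // => i _.
    by rewrite le_max lexx.
  by rewrite le_max lexx orbT.
have eq2 : \sum_i m i = \sum_(i < n | (i <= k)%N) (y i 0 - y k 0).
  rewrite (bigID (fun i : 'I_n => (i <= k)%N)) /= [X in _ + X]big1 ?addr0.
    by apply: eq_bigr => i ik; apply/max_idPl; rewrite subr_ge0 y_mono.
  move=> i; rewrite -ltnNge => ki; apply/max_idPr.
  by rewrite subr_le0 y_mono // ltnW.
move: le1; rewrite msum eq2 -subr_le0 -sumrB.
by under eq_bigr do rewrite opprB addrA subrK.
Qed.

End SortedVectors.

(** * Abel summation and the rearrangement inequality *)

Lemma abel_sum_ge (R : realType) (a b : nat -> R) (n : nat) :
  (forall i j, (i <= j <= n)%N -> a j <= a i) ->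
  (forall k, (k <= n)%N -> 0 <= \sum_(i < k.+1) b i) ->
  a n * \sum_(i < n.+1) b i <= \sum_(i < n.+1) a i * b i.
Proof.
elim: n => [|n IHn] a_mono b_ge0; first by rewrite !big_ord1.
rewrite big_ord_recr [leRHS]big_ord_recr /= mulrDr lerD2r.
(* The prefix sum is nonnegative, so its weight may be lowered from [a n] to [a n.+1]. *)
apply: le_trans (IHn _ _).
- by rewrite ler_wpM2r ?b_ge0 // a_mono // leqnSn leqnn.
- by move=> i j /andP[ij jn]; rewrite a_mono // ij leqW.
- by move=> k kn; rewrite b_ge0 // leqW.
Qed.

(** Nonnegative prefix sums put [b] in the dual cone of the monotone cone: by Abel summation the
    product is at least the last entry of [a] times the total of [b]. *)
Lemma dotv_prefix_ge0 (R : realType) (n : nat) (a b : 'cV[R]_n.+1) :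
  monotone_nonneg_cone R n.+1 a ->
  (forall k : 'I_n.+1, 0 <= \sum_(i < n.+1 | (i <= k)%N) b i 0) ->
  0 <= dotv a b.
Proof.
move=> [a_mono a_ge0] b_ge0.
have prefix k : (k <= n)%N -> 0 <= \sum_(i < k.+1) b (inord i) 0.
  move=> kn; rewrite (big_ord_widen n.+1 (fun i => b (inord i) 0)) //.
  have := b_ge0 (inord k); rewrite inordK //; congr (_ <= _).
  by apply: eq_bigr => i _; rewrite inord_val.
have -> : dotv a b = \sum_(i < n.+1) a (inord i) 0 * b (inord i) 0.
  by rewrite dotvE; apply: eq_bigr => i _; rewrite inord_val.
apply: le_trans (@abel_sum_ge R (fun i => a (inord i) 0) (fun i => b (inord i) 0) n _ prefix).
  by rewrite mulr_ge0 ?prefix.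
move=> i j /andP[ij jn]; apply: a_mono.
by rewrite !inordK //= ltnS (leq_trans ij).
Qed.

(** Sorting maximizes every prefix sum, so the sorted vector minus any rearrangement of it has
    nonnegative prefix sums. *)
Lemma rearrangement (R : realType) (n : nat) (a x : 'cV[R]_n.+1) (s : 'S_n.+1) :
  monotone_nonneg_cone R n.+1 a ->
  dotv a (row_perm s x) <= dotv a (sortv_decr x).
Proof.
move=> Ka; have [t tE] := sortv_decrP x.
have -> : row_perm s x = row_perm (s * t^-1)%g (sortv_decr x).
  by apply/colP => i; rewrite tE !mxE permM permKV.
rewrite -subr_ge0 -dotvNr -dotvDr; apply: dotv_prefix_ge0 => // k.
have := @sum_row_perm_prefix _ _ (s * t^-1)%g _ k (@sortv_decr_mono _ _ x).
rewrite -subr_ge0 -sumrB; congr (_ <= _).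
by apply: eq_bigr => i _; rewrite !mxE.
Qed.

(** * Projection onto the monotone cone: existence, regularity, residual *)

Section ConeProjection.
Context {R : realType} {n : nat}.
Implicit Types (x y z p q u w : 'cV[R]_n).

Local Notation K := (monotone_nonneg_cone R n).

(** Row vectors are used to match [rV_compact], which provides the compact box. *)
Lemma closed_cone_row : closed [set r : 'rV[R]_n | K r^T].
Proof.
have -> : [set r : 'rV[R]_n | K r^T] =
    (\bigcap_(ij in [set ij : 'I_n * 'I_n | (ij.1 <= ij.2)%N])
       [set r : 'rV[R]_n | 0 <= r 0 ij.1 - r 0 ij.2]) `&`
    (\bigcap_(i in [set: 'I_n]) [set r : 'rV[R]_n | 0 <= r 0 i]).
  apply/seteqP; split=> r /=.
    move=> [r1 r2]; split=> [[i j] /= ij|i _] /=.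
      by have := r1 _ _ ij; rewrite !mxE subr_ge0.
    by have := r2 i; rewrite mxE.
  move=> [r1 r2]; split=> [i j ij|i]; rewrite !mxE; last exact: r2.
  by rewrite -subr_ge0; exact: (r1 (i, j)).
have coord i : continuous (fun r : 'rV[R]_n => r 0 i) :=
  @coord_continuous R 1 n 0 i.
have coordB i j : continuous (fun r : 'rV[R]_n => r 0 i - r 0 j).
  by move=> r; apply: continuousB; exact: coord.
apply: closedI.
  apply: closed_bigI => ij _.
  by apply: closed_comp (@closed_ge R 0) => r _; exact: coordB.
apply: closed_bigI => i _.
by apply: closed_comp (@closed_ge R 0) => r _; exact: coord.
Qed.

Lemma continuous_sqr_dist_row x :
  continuous (fun r : 'rV[R]_n => dotv (x - r^T) (x - r^T)).
Proof.
have -> : (fun r : 'rV[R]_n => dotv (x - r^T) (x - r^T)) =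
    (fun r => \sum_(i < n) (x i 0 - r 0 i) * (x i 0 - r 0 i)).
  by apply/funext => r; rewrite dotvE; apply: eq_bigr => i _; rewrite !mxE.
have coordB i : continuous (fun r : 'rV[R]_n => x i 0 - r 0 i).
  move=> r; apply: continuousB; first exact: cst_continuous.
  exact: (@coord_continuous R 1 n 0 i).
have sqB i : continuous (fun r : 'rV[R]_n => (x i 0 - r 0 i) * (x i 0 - r 0 i)).
  by move=> r; exact: (continuousM (coordB i r) (coordB i r)).
by apply: continuous_big => [|i _]; [exact: add_continuous|exact: sqB].
Qed.

(* Capping the entries of a point of [K] at a bound for the entries of [x]
   stays in [K] and moves the point closer to [x], so that the minimum can be
   sought in a compact box. *)
Lemma cone_proj_exists x : exists p, is_proj K x p.
Proof.
(* This bound is nonnegative even for [n = 0], so the box contains [0]. *)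
pose M := \sum_i `|x i 0|.
have xM i : x i 0 <= M.
  apply: le_trans (ler_norm _) _.
  by rewrite /M (bigD1 i) //= lerDl sumr_ge0.
have M0 : 0 <= M by rewrite sumr_ge0.
pose box := [set r : 'rV[R]_n | forall i, `[0, M]%classic (r ord0 i)].
have cbox : compact (box `&` [set r | K r^T]).
  apply: compact_closedI closed_cone_row.
  by apply: (@rV_compact R n (fun=> `[0, M]%classic)) => i; exact: segment_compact.
have [|r rK rmin] := compact_EVT_min _ cbox
    (continuous_subspaceT (@continuous_sqr_dist_row x)).
  exists 0; split; first by move=> i; rewrite /= in_itv /= mxE lexx M0.
  by rewrite /= trmx0; exact: cone0.
exists r^T; split; first by case: (set_mem rK).
move=> q [q1 q2]; rewrite ler_l2norm.
pose c := \row_i Num.min (q i 0) M.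
have /rmin /le_trans -> // : c \in box `&` [set r | K r^T].
  apply/mem_set; split=> [i|].
    by rewrite /= in_itv /= mxE le_min q2 M0 /= ge_min lexx orbT.
  split=> [i j ij|i]; rewrite !mxE; last by rewrite le_min q2.
  by rewrite le_min !ge_min q1 // lexx orbT.
rewrite !dotvE ler_sum // => i _; rewrite !mxE -!expr2.
have := xM i; case: (leP (q i 0) M) => // qM xiM.
rewrite -[leLHS]sqrrN -[leRHS]sqrrN ler_sqr ?nnegrE; lra.
Qed.

Lemma cone_projP x : is_proj K x (proj K x).
Proof.
have [p xp] := cone_proj_exists x.
exact: (@xgetPex _ 0 [set p | is_proj K x p]) (ex_intro _ p xp).
Qed.

Lemma proj_cone_id x : K x -> proj K x = x.
Proof.
move=> Kx; apply: cone_proj_eq => // [|q _];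
  by rewrite subrr dotvC dotv0r.
Qed.

(** Add the variational inequalities at the two projections, each tested at the other projection. *)
Lemma proj_cone_firmly_nonexpansive x y :
  dotv (proj K x - proj K y) (proj K x - proj K y)
    <= dotv (x - y) (proj K x - proj K y).
Proof.
have [Kp _] := cone_projP x; have [Kq _] := cone_projP y.
have := cone_variational (cone_projP x) Kq.
have := cone_variational (cone_projP y) Kp.
rewrite !dotv_bilin; move: (proj K x) (proj K y) => p q.
rewrite (dotvC q p); lra.
Qed.

Lemma cauchy_schwarz x y : dotv x y ^+ 2 <= dotv x x * dotv y y.
Proof.
have [/dotvv_eq0 ->|x0] := eqVneq (dotv x x) 0.
  by rewrite (dotvC 0) dotv0r expr0n dotv0r mul0r.
have xx : 0 < dotv x x by rewrite lt_neqAle eq_sym x0 dotvv_ge0.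
have := dotvv_ge0 (dotv x x *: y - dotv x y *: x).
rewrite !dotv_bilin (dotvC y x) => H.
have : 0 <= dotv x x * (dotv x x * dotv y y - dotv x y ^+ 2) by lra.
by rewrite pmulr_rge0 // subr_ge0.
Qed.

(** With [d] the difference of the projections, Cauchy-Schwarz and firm nonexpansiveness give
    [<w,d>^2 <= |w|^2 |d|^2 <= |w|^2 (t - s) <w,d>]; then divide by the absolute value of
    [<w,d>]. *)
Lemma proj_cone_dot_lipschitz u w (s t : R) :
  `|dotv w (proj K (u - s *: w)) - dotv w (proj K (u - t *: w))|
    <= dotv w w * `|s - t|.
Proof.
rewrite -dotvNr -dotvDr.
have := proj_cone_firmly_nonexpansive (u - s *: w) (u - t *: w).
set d := proj K _ - proj K _.
have -> : u - s *: w - (u - t *: w) = (t - s) *: w.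
  by apply/colP => i; rewrite !mxE; ring.
rewrite dotvZl => dd; have cs := cauchy_schwarz w d.
have [->|h0] := eqVneq (dotv w d) 0.
  by rewrite normr0 mulr_ge0 ?dotvv_ge0.
rewrite -(ler_pM2r (_ : 0 < `|dotv w d|)) ?normr_gt0 // -normrM -expr2.
rewrite ger0_norm ?sqr_ge0 //; apply: le_trans cs _.
rewrite -mulrA ler_wpM2l ?dotvv_ge0 //; apply: le_trans dd _.
by rewrite distrC -normrM ler_norm.
Qed.

(** Supplies the one-entry moves of [p] used as test points in [sub_proj_cone]. *)
Lemma cone_perturb p (i : 'I_n) (k : R) : K p ->
  (forall j : 'I_n, (j < i)%N -> p i 0 + k <= p j 0) ->
  (forall j : 'I_n, (i < j)%N -> p j 0 <= p i 0 + k) ->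
  0 <= p i 0 + k ->
  K (p + k *: delta_mx i 0).
Proof.
move=> [p1 p2] below above pk.
have E j : (p + k *: delta_mx i 0) j 0 = if j == i then p i 0 + k else p j 0.
  by rewrite !mxE eqxx andbT; case: eqP => [->|_]; rewrite ?mulr1 // mulr0 addr0.
split=> [j l jl|j]; rewrite !E; last by case: ifP.
have [li|li] := eqVneq l i; have [ji|ji] := eqVneq j i => //.
- by apply: below; rewrite -li ltn_neqAle jl andbT -[_ == _]/(j == l) li.
- by apply: above; rewrite -ji ltn_neqAle jl andbT -[_ == _]/(j == l) eq_sym ji.
- exact: p1.
Qed.

Lemma adjacent_mono y :
  (forall i j : 'I_n, j = i.+1 :> nat -> y j 0 <= y i 0) ->
  forall i j : 'I_n, (i <= j)%N -> y j 0 <= y i 0.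
Proof.
move=> adj i j /subnK; move: (j - i)%N => m.
elim: m j => [|m IHm] j mij.
  by rewrite (_ : j = i) //; apply: val_inj.
have ltn : (m + i < n)%N by rewrite -addSn mij ltnW // ltnS ltnW // ltn_ord.
by apply: le_trans (IHm (Ordinal ltn) _) => //; apply: adj; rewrite -mij addSn.
Qed.

(* Where [p] drops, it can be lowered just before the drop and raised just
   after it without leaving [K]; hence, with [z = u - w], [p <= z] before the
   drop and [z <= p] after it. *)
Lemma sub_proj_cone u w : K u -> K w -> K (u - proj K (u - w)).
Proof.
move=> [u1 u2] [w1 w2]; have zp := cone_projP (u - w).
move: (proj _ _) zp => p zp; have [Kp _] := zp; have [p1 p2] := Kp.
have test i k : K (p + k *: delta_mx i 0) -> k * (u i 0 - w i 0 - p i 0) <= 0.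
  move/(cone_variational zp); rewrite [p + _]addrC addrK dotv_delta.
  by rewrite !mxE.
have adj (i j : 'I_n) : j = i.+1 :> nat -> u j 0 - p j 0 <= u i 0 - p i 0.
  move=> ij; have ltij : (i < j)%N by rewrite ij.
  (* Without a drop [p i = p j], and [u] decreases. At a drop of size [k], lowering entry [i] to
     [p j] and raising entry [j] to [p i] yield [u i - p i >= w i >= w j >= u j - p j]. *)
  have [pij|pij] := leP (p i 0) (p j 0).
    by have := u1 i j (ltnW ltij); have := p1 i j (ltnW ltij); lra.
  pose k := p i 0 - p j 0; have k0 : 0 < k by rewrite subr_gt0.
  have Ki : K (p + (- k) *: delta_mx i 0).
    apply: cone_perturb => // [l li|l il|]; rewrite opprB addrC subrK //.
      by rewrite (le_trans (ltW pij)) // p1 // ltnW.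
    by rewrite p1 // ij.
  have Kj : K (p + k *: delta_mx j 0).
    apply: cone_perturb => // [l lj|l jl|]; rewrite addrC subrK //.
      by rewrite p1 // -ltnS -ij.
    by rewrite (le_trans _ (ltW pij)) // p1 // ltnW.
  have := test _ _ Ki; have := test _ _ Kj.
  rewrite pmulr_rle0 // mulNr oppr_le0 pmulr_rge0 // => zj zi.
  by have := w1 i j (ltnW ltij); lra.
have mono := @adjacent_mono (u - p).
have Kup : forall i j : 'I_n, (i <= j)%N -> (u - p) j 0 <= (u - p) i 0.
  by apply: mono => i j ij; rewrite !mxE adj.
split=> // i; have n0 : (0 < n)%N by case: n i {Kup} => // -[].
have ltn : (n.-1 < n)%N by rewrite prednK.
(* Only the last entry remains to be checked: either [p l <= 0 <= u l], or lowering [p l] to [0]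
   stays in [K] and gives [p l <= u l - w l <= u l]. *)
pose l := Ordinal ltn.
apply: le_trans (Kup i l _); last by rewrite /= -ltnS prednK.
rewrite !mxE subr_ge0; have [pl|pl] := leP (p l 0) 0.
  exact: le_trans pl (u2 l).
have Kl : K (p + (- p l 0) *: delta_mx l 0).
  apply: cone_perturb => // [j jl|j|]; rewrite subrr //.
  by rewrite ltnNge -ltnS prednK // ltn_ord.
have := test _ _ Kl; rewrite mulNr oppr_le0 pmulr_rge0 // => zl.
by have := w2 l; lra.
Qed.

(** The products [(x i - x j) (y i - y j)] are nonnegative, and their double sum is twice the
    difference of the two sides. *)
Lemma chebyshev_sum x y :
  (forall i j : 'I_n, (i <= j)%N -> x j 0 <= x i 0) ->
  (forall i j : 'I_n, (i <= j)%N -> y j 0 <= y i 0) ->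
  (\sum_i x i 0) * (\sum_i y i 0) <= n%:R * dotv x y.
Proof.
move=> x_mono y_mono.
have : 0 <= \sum_i \sum_j (x i 0 - x j 0) * (y i 0 - y j 0).
  rewrite sumr_ge0 // => i _; rewrite sumr_ge0 // => j _.
  case/orP: (leq_total i j) => [ij|ji].
    by rewrite mulr_ge0 // subr_ge0 ?x_mono ?y_mono.
  by rewrite -mulrNN mulr_ge0 // opprB subr_ge0 ?x_mono ?y_mono.
set S := \sum_i _.
suff -> : S = 2 * (n%:R * dotv x y - (\sum_i x i 0) * (\sum_i y i 0)).
  by rewrite pmulr_rge0 // subr_ge0.
have rowE i : \sum_j (x i 0 - x j 0) * (y i 0 - y j 0) =
    n%:R * (x i 0 * y i 0) - x i 0 * (\sum_j y j 0)
    - (\sum_j x j 0) * y i 0 + dotv x y.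
  have -> : n%:R * (x i 0 * y i 0) = \sum_(j < n) x i 0 * y i 0.
    by rewrite sumr_const card_ord mulr_natl.
  rewrite dotvE mulr_sumr mulr_suml -!sumrN.
  by rewrite -!big_split /=; apply: eq_bigr => j _; ring.
rewrite /S; under eq_bigr do rewrite rowE.
rewrite !big_split /= !sumrN -mulr_sumr -mulr_suml -mulr_sumr.
by rewrite sumr_const card_ord -mulr_natl dotvE; ring.
Qed.

End ConeProjection.

Lemma lipschitz_real_continuous (R : realType) (f : R -> R) (L : R) :
  (forall s t, `|f s - f t| <= L * `|s - t|) -> continuous f.
Proof.
move=> fL s; apply/cvgrPdist_lt => e e0.
(* [L] may be zero or negative, so [e] is divided by a positive bound above [L]. *)
have L1 : 0 < `|L| + 1 by rewrite ltr_wpDl.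
have /cvgrPdist_lt/(_ _ (divr_gt0 e0 L1)) : id @ s --> s by exact: cvg_id.
apply: filterS => t; rewrite ltr_pdivlMr // mulrC; apply: le_lt_trans.
apply: le_trans (fL s t) _.
by rewrite ler_wpM2r // (le_trans (ler_norm _)) // lerDl.
Qed.

(** * The root of [g] and the projection onto the OWL ball *)

Section OWLBall.
Context {R : realType} {n : nat}.
Implicit Types (u v w p q x : 'cV[R]_n.+1) (eps theta : R).

Local Notation K := (monotone_nonneg_cone R n.+1).

Lemma mean_cone_gt0 w : K w -> w != 0 -> 0 < l1norm w / n.+1%:R.
Proof.
move=> Kw w0; rewrite divr_gt0 ?ltr0n // lt_neqAle eq_sym sumr_ge0 // andbT.
apply: contra_neq w0 => /eqP; rewrite psumr_eq0 // => /allP w0.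
apply/colP => i; apply/eqP; rewrite mxE -normr_eq0.
exact: w0 (mem_index_enum i).
Qed.

(** For [q] in [K], Chebyshev bounds the mean of [w] times the sum of [q] by [<w,q>], while [<u,q>]
    is at most the first entry of [u] times that sum. Dividing by the mean gives polarity at this
    multiple of [w]. *)
Lemma proj_cone_eq0 u w : K u -> K w -> w != 0 ->
  proj K (u - (u ord0 0 / (l1norm w / n.+1%:R)) *: w) = 0.
Proof.
move=> [u1 u2] Kw w0; have [w1 w2] := Kw; have wbar0 := mean_cone_gt0 Kw w0.
apply: cone_proj_eq; [exact: cone0|exact: dotv0r|move=> q [q1 q2]].
rewrite subr0 !dotv_bilin subr_le0.
have uq : dotv u q <= u ord0 0 * \sum_i q i 0.
  by rewrite dotvE mulr_sumr ler_sum // => i _; rewrite ler_wpM2r // u1.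
have wq : l1norm w / n.+1%:R * \sum_i q i 0 <= dotv w q.
  rewrite mulrAC ler_pdivrMr ?ltr0n // [leRHS]mulrC.
  have -> : l1norm w = \sum_i w i 0 by apply: eq_bigr => i _; rewrite ger0_norm.
  exact: chebyshev_sum.
apply: le_trans uq _; rewrite -mulrA ler_wpM2l //.
by rewrite mulrC ler_pdivlMr // mulrC.
Qed.

Lemma owl_root u w eps : K u -> K w -> w != 0 -> 0 < eps -> eps < dotv w u ->
  exists theta, theta \in `[0, u ord0 0 / (l1norm w / n.+1%:R)] /\
    dotv w (proj K (u - theta *: w)) - eps = 0.
Proof.
move=> Ku Kw w0 eps0 epsu; have [_ u2] := Ku.
set b := u ord0 0 / _; pose f theta := dotv w (proj K (u - theta *: w)).
have b0 : 0 <= b by rewrite divr_ge0 // ltW // mean_cone_gt0.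
have fC : continuous f by exact: lipschitz_real_continuous (proj_cone_dot_lipschitz u w).
have f0 : f 0 = dotv w u by rewrite /f scale0r subr0 proj_cone_id.
have fb : f b = 0 by rewrite /f /b proj_cone_eq0 // dotv0r.
have [|theta thetab ftheta] := @IVT R f 0 b eps b0 (continuous_subspaceT fC).
  rewrite f0 fb ge_min le_max (ltW eps0) (ltW epsu) orbT //.
by exists theta; split=> //; rewrite -/(f theta) ftheta subrr.
Qed.

(* The signs of [v] may vanish: the entries of [p] are carried to the right
   places only because [p] vanishes wherever [u] does. *)
Lemma proj_owl_ball_formula w v eps theta (s : 'S_n.+1) :
  let u := sortv_decr (absv v) in
  K w -> u = row_perm s (absv v) -> 0 <= theta ->
  dotv w (proj K (u - theta *: w)) = eps ->
  proj (owl_ball w eps) v =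
    hadamard (signv v) (row_perm s^-1%g (proj K (u - theta *: w))).
Proof.
move=> u Kw uE theta0; have Ku : K u by exact: sortv_absv_cone.
clearbody u; have := sub_proj_cone Ku (coneZ theta0 Kw).
have := cone_projP (u - theta *: w); move: (proj K _) => p zp Kup wp.
have [Kp _] := zp.
have [_ p2] := Kp; have [_ up2] := Kup.
set p' := row_perm _ p; set x := hadamard _ _.
have p'E i : p' (s i) 0 = p i 0 by rewrite !mxE permK.
have p'_ge0 i : 0 <= p' i 0 by rewrite mxE.
have uEi i : u i 0 = `|v (s i) 0| by rewrite uE !mxE.
have upE i : (u - p) i 0 = u i 0 - p i 0 by rewrite mxE [(- p) _ _]mxE.
have le_p' i : p' i 0 <= `|v i 0|.
  by have := up2 (s^-1%g i); rewrite upE uEi permKV mxE subr_ge0.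
have xE i : x i 0 = Num.sg (v i 0) * p' i 0 by rewrite !mxE.
have absx : absv x = p'.
  apply/colP => i; rewrite mxE xE normrM (ger0_norm (p'_ge0 i)) normr_sg.
  have [vi0|] := eqVneq (v i 0) 0; last by rewrite mul1r.
  rewrite mul0r; apply/eqP; rewrite eq_le p'_ge0.
  by have := le_p' i; rewrite vi0 normr0.
have owlx : owl_norm w x = eps.
  by rewrite /owl_norm absx sortv_decr_row_perm sortv_decr_id //; case: Kp.
apply: proj_eq => [|q owlq]; first by rewrite /owl_ball /= owlx.
(* Both [v] and [x] carry the sign of [v], so in sorted order their difference is that sign times
   [u - p]. *)
have vxE i : (v - x) (s i) 0 = Num.sg (v (s i) 0) * (u - p) i 0.
  rewrite mxE [(- x) _ _]mxE xE p'E upE uEi mulrBr -numEsg //.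
have vx_x : dotv (v - x) x = theta * eps.
  have -> : theta * eps = dotv (u - p) p.
    by have := cone_proj_orthogonal zp; rewrite -wp !dotv_bilin => H; lra.
  rewrite !dotvE (reindex_inj (@perm_inj _ s)) /=; apply: eq_bigr => i _.
  rewrite vxE xE p'E mulrACA -expr2 sqr_sg.
  have [vi0|] := eqVneq (v (s i) 0) 0; last by rewrite mul1r.
  have : p i 0 <= 0 by rewrite -p'E (le_trans (le_p' _)) // vi0 normr0.
  by move=> pi0; rewrite (_ : p i 0 = 0) ?mulr0 //; apply/le_anti; rewrite pi0 p2.
(* Since [u - p >= 0], each signed entry of [q] may be replaced by its absolute value; rearrangement
   then sorts them and polarity trades [u - p] for [theta w]. *)
have vx_q : dotv (v - x) q <= theta * eps.
  apply: (@le_trans _ _ (dotv (u - p) (row_perm s (absv q)))).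
    rewrite !dotvE (reindex_inj (@perm_inj _ s)) /=; apply: ler_sum => i _.
    rewrite vxE mulrAC mulrC ler_wpM2l // !mxE.
    rewrite (le_trans (ler_norm _)) // normrM normr_sg.
    by case: eqP => _; rewrite ?mul0r // mul1r.
  apply: le_trans (rearrangement _ _ Kup) _.
  have := cone_proj_polar zp (sortv_absv_cone q).
  rewrite !dotv_bilin => H.
  have : theta * owl_norm w q <= theta * eps by rewrite ler_wpM2l.
  by rewrite /owl_norm; lra.
by rewrite dotvDr dotvNr vx_x subr_le0.
Qed.

End OWLBall.

Theorem mainTheorem5 (R : realType) (n : nat) (w v : 'cV[R]_n.+1) (eps : R)
    (w_cone : monotone_nonneg_cone R n.+1 w) (w_neq0 : w != 0)
    (eps_gt0 : 0 < eps) :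
  (owl_norm w v <= eps -> proj (owl_ball w eps) v = v) /\
  (eps < owl_norm w v ->
   let K := monotone_nonneg_cone R n.+1 in
   let u := sortv_decr (absv v) in
   let wbar := l1norm w / n.+1%:R in
   let g := fun theta : R => dotv w (proj K (u - theta *: w)) - eps in
   (exists theta : R, theta \in `[0, u ord0 0 / wbar] /\ g theta = 0) /\
   (forall (P : 'M[R]_n.+1) (theta : R),
      is_perm_mx P -> u = P *m absv v ->
      theta \in `[0, u ord0 0 / wbar] -> g theta = 0 ->
      proj (owl_ball w eps) v =
        hadamard (signv v) (P^T *m proj K (u - theta *: w)))).
Proof.
split=> [owlv|owlv K u wbar g].
  by apply: proj_eq => // q _; rewrite subrr dotvC dotv0r.
split; first exact: owl_root (sortv_absv_cone v) w_cone w_neq0 eps_gt0 owlv.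
(* [P] acts as [row_perm s] and its transpose as [row_perm] of the inverse, so every way of breaking
   ties is covered. *)
move=> P theta /is_perm_mxP[s ->]; rewrite -row_permE tr_perm_mx -row_permE.
move=> uE; rewrite in_itv /= => /andP[theta0 _] /eqP; rewrite subr_eq0 => /eqP.
exact: proj_owl_ball_formula.
Qed.
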